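(* Let $\mathbb K=\mathbb R$ or $\mathbb C$ and let $f:\mathbb K^3\to\mathbb K$ be a KND real polynomial function (if $\mathbb K=\mathbb R$) or mixed polynomial function (if $\mathbb K=\mathbb C$). Assume: (i) for every $i\in I_{\mathrm{nc}}(f)$ there exist an index $j\ne i$ and a point $p^{(i)}\in\mathrm{supp}(f)\cap\Gamma(f)\cap\mathbb R^{\{i,j\}}$ with $j$-th coordinate $p^{(i)}_j=1$; (ii) $\mathrm{supp}(f)\cap\Gamma(f)\cap\mathbb R^{\{i,j\}}\ne\emptyset$ for all distinct $i,j\in\{1,2,3\}$; (iii) for every $i\in I_{\mathrm{nc}}(f)$, the function $M_i:=f_{\{p^{(i)}\}}$ satisfies $V(M_i)\cap(\mathbb K^* )^3=\emptyset$. Then $f$ is IKND.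
   Context: Notation. A real polynomial function $f:\mathbb R^3\to\mathbb R$ is a polynomial with $f(0)=0$; a mixed polynomial function $f:\mathbb C^3\to\mathbb C$ is a finite sum $\sum c_{\nu,\mu}x^\nu\bar x^\mu$, $c_{\nu,\mu}\in\mathbb C$, with $f(0)=0$. $\mathrm{supp}(f)=\{\nu:c_\nu\ne0\}$ in the real case and $\{\nu+\mu:c_{\nu,\mu}\neq0\}$ in the mixed case. For $A\subset\mathbb R^3$, $f_A$ is the sum of the terms of $f$ whose exponent $\nu$ (resp. $\nu+\mu$) lies in $A$. For $w\in(\mathbb Q_{>0})^3$, $d(w;f)=\min\{\langle w,\nu\rangle:\nu\in\mathrm{supp}(f)\}$ and $f_w$ is the sum of the terms attaining this minimum. $V(f)=f^{-1}(0)$; $\Sigma(f)$ is the set of points where the real Jacobian of $f$ has rank $<1$ if $\mathbb K=\mathbb R$, rank $<2$ if $\mathbb K=\mathbb C$. For $I\subset\{1,2,3\}$, $\mathbb K^I=\{x\in\mathbb K^3:x_i=0\ \forall i\notin I\}$ and $(\mathbb K^* )^I=\{x\in\mathbb K^I:x_i\neq0\ \forall i\in I\}$. The Newton boundary $\Gamma(f)$ is the union of the compact faces of the convex hull of $\bigcup_{\nu\in\mathrm{supp}(f)}(\nu+(\mathbb R_{\ge0})^3)$. $I_{\mathrm{nc}}(f)=\{i:\mathrm{supp}(f)\cap\mathbb R^{\{i\}}=\emptyset\}$. KND. $f$ is KND if $\Sigma(f_w)\cap V(f_w)\cap(\mathbb K^* )^3=\emptyset$ for every $w\in(\mathbb N_{>0})^3$.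 $C$-face diagrams and IKND. A $C$-face diagram is $D=\{\nu\in(\mathbb R_{\ge0})^3:\min_{\ell\in J}\ell(\nu)=1\}$, with $J$ a nonempty finite set of linear forms with positive rational coefficients. For $w\in(\mathbb Q_{>0})^3$, $d(w;D)=\min_{\nu\in D}\langle w,\nu\rangle$, attained on $\Delta(w;D)$. $\mathcal P(D)\subset(\mathbb Q_{>0})^3$ consists of one weight vector $w$ for each $2$-dimensional face $\Delta(w;D)$ of $D$. A face of $D$ is a nonempty set $\{\nu\in D:\nu_i=0\ (i\notin I_\Delta),\ \ell(\nu)=1\ (\ell\in J_\Delta)\}$ with $I_\Delta\subset\{1,2,3\}$, $\emptyset\neq J_\Delta\subset J$; it is inner if not contained in any proper coordinate subspace. $f$ is IKND if there is a $C$-face diagram $D$ such that (a) $d(w;f)\ge d(w;D)$ for all $w\in\mathcal P(D)$, and (b) for every inner face $\Delta$ of $D$ and every nonempty $I\subset\{1,2,3\}$ with $\Delta\cap\mathbb R^I\ne\emptyset$, $\Sigma(f_\Delta)\cap V(f_\Delta)\cap(\mathbb K^* )^I=\emptyset$. *)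

(* Defs.v *)
(* mpoly must be imported before mathcomp-analysis: in the other order their
   notations have incompatible precedence levels. *)
From HB Require Import structures.
From mathcomp Require Import all_boot all_order all_algebra finmap.
From mathcomp Require Import mpoly complex.
From mathcomp Require Import all_classical all_reals all_analysis.

Set Implicit Arguments.
Unset Strict Implicit.
Unset Printing Implicit Defensive.

Import Order.TTheory GRing.Theory Num.Theory.
Import numFieldNormedType.Exports.

Local Open Scope classical_set_scope.
Local Open Scope complex_scope.
Local Open Scope ring_scope.

Section Coordinates.
Variable K : nmodType.

Definition coord_space (I : {set 'I_3}) : set 'rV[K]_3 :=
  [set x | forall i, i \notin I -> x 0 i = 0].

Definition coord_torus (I : {set 'I_3}) : set 'rV[K]_3 :=
  [set x | coord_space I x /\ forall i, i \in I -> x 0 i != 0].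

End Coordinates.

Section ConvexGeometry.
Variable R : realType.
Implicit Types (w nu : 'rV[R]_3) (S : set 'rV[R]_3).

Definition pairing w nu : R := \sum_(i < 3) w 0 i * nu 0 i.

(* The infimum is a minimum in all uses below, where w is positive and S is
   the support of a nonzero polynomial or a C-face diagram. *)
Definition min_value w S : R := inf [set pairing w nu | nu in S].

Definition min_locus w S : set 'rV[R]_3 :=
  [set nu | S nu /\ forall nu', S nu' -> pairing w nu <= pairing w nu'].

Definition orthant : set 'rV[R]_3 := [set x | forall i, 0 <= x 0 i].

(* The affine hull of S has dimension n: all differences with a base point nu
   of S lie in the span of n independent ones. *)
Definition has_dim (n : nat) S : Prop :=
  exists nu, S nu /\ exists A : 'M[R]_(n, 3),
    [/\ \rank A = n, forall i, S (nu + row i A)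
      & forall nu', S nu' -> (nu' - nu <= A)%MS].

Definition newton_polyhedron S : set 'rV[R]_3 :=
  smallest (fun C : set 'rV[R]_3 => convex_set C)
    [set nu + x | nu in S & x in orthant].

(* Faces of the polyhedron are its intersections with supporting planes. *)
Definition newton_boundary S : set 'rV[R]_3 :=
  \bigcup_(F in [set F | compact F /\
                  exists a, F = min_locus a (newton_polyhedron S)]) F.

End ConvexGeometry.

Section CFaceDiagrams.
Variable R : realType.
(* A linear form with rational coefficients is represented by the row vector
   of its coefficients, as is a rational weight vector. *)
Implicit Types (w : 'rV[rat]_3) (J : {fset 'rV[rat]_3}) (D : set 'rV[R]_3).

Definition positive_weight w : Prop := forall i, 0 < w 0 i.

Definition real_weight w : 'rV[R]_3 := map_mx ratr w.

Definition cface_family J : Prop :=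
  (exists l, l \in J) /\ forall l, l \in J -> positive_weight l.

Definition cface_diagram J : set 'rV[R]_3 :=
  [set nu | orthant nu /\
     (forall l, l \in J -> 1 <= pairing (real_weight l) nu) /\
     exists l, l \in J /\ pairing (real_weight l) nu = 1].

(* P is a possible choice of the set P(D): exactly one positive rational weight
   vector for each 2-dimensional face Delta(w; D). *)
Definition face_weights D (P : set 'rV[rat]_3) : Prop :=
  (forall w, P w ->
     positive_weight w /\ has_dim 2 (min_locus (real_weight w) D)) /\
  (forall w, positive_weight w -> has_dim 2 (min_locus (real_weight w) D) ->
     exists! w', P w' /\
       min_locus (real_weight w') D = min_locus (real_weight w) D).

(* Faces refer to the family J and not only to the set D, so a C-face diagram
   is given by J. *)
Definition cface_face J (Delta : set 'rV[R]_3) : Prop :=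
  Delta !=set0 /\
  exists (I : {set 'I_3}) (J' : {fset 'rV[rat]_3}),
    [/\ (exists l, l \in J'), (forall l, l \in J' -> l \in J)
      & Delta = [set nu | [/\ cface_diagram J nu,
                            (forall i, i \notin I -> nu 0 i = 0)
                          & forall l, l \in J' ->
                              pairing (real_weight l) nu = 1]]].

Definition inner (Delta : set 'rV[R]_3) : Prop :=
  forall I : {set 'I_3}, I != [set: 'I_3]%SET -> ~ (Delta `<=` coord_space I).

End CFaceDiagrams.

Variant base_field : Set := RealField | ComplexField.

Section Functions.
Variable R : realType.

Definition ground_field (k : base_field) : numFieldType :=
  match k with RealField => R | ComplexField => R[i] end.

(* A mixed polynomial in x is a polynomial in the three variables x_i
   (indices [lshift 3 i]) and the three variables conj x_i
   (indices [rshift 3 i]). *)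
Definition nvars (k : base_field) : nat :=
  match k with RealField => 3 | ComplexField => 3 + 3 end.

Definition polyfun (k : base_field) := {mpoly (ground_field k)[nvars k]}.

Definition var_values (k : base_field)
  : 'rV[ground_field k]_3 -> 'I_(nvars k) -> ground_field k :=
  match k return 'rV[ground_field k]_3 -> 'I_(nvars k) -> ground_field k with
  | RealField => fun (x : 'rV[R]_3) (i : 'I_3) => x 0 i
  | ComplexField => fun (x : 'rV[R[i]]_3) (i : 'I_(3 + 3)) =>
      match fintype.split i with
      | inl j => x 0 j
      | inr j => (x 0 j)^*
      end
  end.

Definition evalf (k : base_field) (f : polyfun k) (x : 'rV[ground_field k]_3)
  : ground_field k := f.@[var_values x].

(* nu for the monomial x^nu, and nu + mu for the monomial x^nu (conj x)^mu *)
Definition exponent_vec (k : base_field) : 'X_{1..nvars k} -> 'rV[R]_3 :=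
  match k return 'X_{1..nvars k} -> 'rV[R]_3 with
  | RealField => fun m : 'X_{1..3} => \row_i (m i)%:R
  | ComplexField => fun m : 'X_{1..3 + 3} =>
      \row_i (m (lshift 3 i) + m (rshift 3 i))%N%:R
  end.

Definition supp (k : base_field) (f : polyfun k) : set 'rV[R]_3 :=
  [set exponent_vec m | m in [set m | m \in msupp f]].

Definition part (k : base_field) (f : polyfun k) (A : set 'rV[R]_3)
  : polyfun k :=
  \sum_(m <- msupp f | `[< A (exponent_vec m) >]) f@_m *: 'X_[m].

Definition face_part (k : base_field) (f : polyfun k) (w : 'rV[R]_3)
  : polyfun k := part f (min_locus w (supp f)).

Definition zeros (k : base_field) (f : polyfun k) : set 'rV[ground_field k]_3 :=
  [set x | evalf f x = 0].

(* C^3 is identified with R^6 through (Re x, Im x), and C with R^2. *)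
Definition to_real (x : 'rV[R[i]]_3) : 'rV[R]_(3 + 3) :=
  row_mx (map_mx (@complex.Re R) x) (map_mx (@complex.Im R) x).

Definition of_real (y : 'rV[R]_(3 + 3)) : 'rV[R[i]]_3 :=
  \row_i (y 0 (lshift 3 i) +i* y 0 (rshift 3 i)).

Definition real_map (f : polyfun RealField) (y : 'rV[R]_3) : 'rV[R]_1 :=
  \row__ (evalf f y : R).

Definition mixed_map (f : polyfun ComplexField) (y : 'rV[R]_(3 + 3))
  : 'rV[R]_(1 + 1) :=
  let z : R[i] := evalf f (of_real y) in
  row_mx (\row__ complex.Re z) (\row__ complex.Im z).

Definition sing (k : base_field) : polyfun k -> set 'rV[ground_field k]_3 :=
  match k return polyfun k -> set 'rV[ground_field k]_3 with
  | RealField => fun f => [set x | (\rank ('J (real_map f) x) < 1)%N]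
  | ComplexField => fun f =>
      [set x | (\rank ('J (mixed_map f) (to_real x)) < 2)%N]
  end.

Definition noncoord (k : base_field) (f : polyfun k) : set 'I_3 :=
  [set i | supp f `&` coord_space [set i]%SET = set0].

Definition KND (k : base_field) (f : polyfun k) : Prop :=
  forall w : 'rV[nat]_3, (forall i, (0 < w 0%R i)%N) ->
    let fw := face_part f (map_mx (fun n => n%:R) w) in
    sing fw `&` zeros fw `&` coord_torus [set: 'I_3]%SET = set0.

Definition IKND (k : base_field) (f : polyfun k) : Prop :=
  exists (J : {fset 'rV[rat]_3}) (P : set 'rV[rat]_3),
    let D := cface_diagram J in
    [/\ cface_family J, face_weights D P,
        forall w, P w ->
          min_value (real_weight R w) D <= min_value (real_weight R w) (supp f)
      & forall (Delta : set 'rV[R]_3) (I : {set 'I_3}),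
          cface_face J Delta -> inner Delta -> I != finset.set0 ->
          Delta `&` coord_space I !=set0 ->
          let fD := part f Delta in
          sing fD `&` zeros fD `&` coord_torus I = set0].

End Functions.

(* Main.v *)
Require Import Defs.
From HB Require Import structures.
From mathcomp Require Import all_boot all_order all_algebra finmap.
From mathcomp Require Import mpoly complex.
From mathcomp Require Import all_classical all_reals all_analysis.
From mathcomp Require Import ring lra.

Set Implicit Arguments.
Unset Strict Implicit.
Unset Printing Implicit Defensive.

Import Order.TTheory GRing.Theory Num.Theory.
Import numFieldNormedType.Exports.
Local Open Scope classical_set_scope.
Local Open Scope ring_scope.

(** The C-face diagram is the Newton boundary of the convenient polynomial
[f + x_1^N + x_2^N + x_3^N] with [N] large: [D] is cut out by the facets, with
positive normals, of the convex hull [H] of [supp f], the points [N e_i] and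
the orthant directions ([newton_diagram]). Condition (a) holds because [supp f]
lies above [D] ([min_value_above]).

For (b), an inner face [Delta] of [D] is the set where a positive weight [w]
attains its minimum [c] on [H] ([inner_face_weight]), so every point of [Delta]
is a convex combination of the points of [supp f] and of the [N e_i] that lie
in [Delta]. Let [Delta] meet [R^I].

- If some point of [supp f] lies in [Delta] and [R^I], raise [w] outside [I].
  The new weight selects the terms of [f] on [Delta] and [R^I], and this face
  function is [f_Delta] composed with the projection onto [K^I]. A singular zero
  of [f_Delta] in the torus of [K^I] would thus lift to a singular zero of that
  face function in the full torus, which KND excludes ([nonsing_restriction]).

- Otherwise [Delta] contains some [N e_i] with [i] in [I], and then [f] has no
  monomial on the [i]-th axis, as it would lie below [w = c]. Let [j] and
  [p = p^(i)] come from (i), let [k] be the third index, and take a point [q]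
  of [supp f] in the [(i, k)] plane from (ii). Since [w] is at least [c = N w_i]
  on both [p] and [q], the weights [w_j] and [w_k] exceed [w_i] by a factor
  larger than any exponent of [f]. Hence a point of [supp f] in [Delta] with
  positive [j]-th coordinate cannot cost more in the directions [j] and [k] than
  [p] does, and since [p] is on the Newton boundary it must be [p]
  ([steep_weight], [newton_boundary_minimal]). An inner face is not contained
  in the plane [nu_j = 0], so [p] is in [Delta], and [j] is not in [I].
  Therefore [f_Delta] is affine in [x_j], with linear part [M_i]; by (iii) this
  is a real-linear injection of [K], so [f_Delta] is a submersion on the torus
  of [K^I] ([nonsing_transverse]). *)

(** * Finitely generated rational cones *)

Section RationalCones.
Variable R : realFieldType.

Definition dot (F : pzRingType) n (x y : 'rV[F]_n) : F := (x *m y^T) 0 0.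

Lemma dotE (F : pzRingType) n (x y : 'rV[F]_n) :
  dot x y = \sum_i x 0 i * y 0 i.
Proof. by rewrite /dot mxE; apply: eq_bigr => i _; rewrite mxE. Qed.

Lemma dot0l (F : pzRingType) n (y : 'rV[F]_n) : dot 0 y = 0.
Proof. by rewrite /dot mul0mx mxE. Qed.

Lemma dot0r (F : pzRingType) n (y : 'rV[F]_n) : dot y 0 = 0.
Proof. by rewrite /dot trmx0 mulmx0 mxE. Qed.

Lemma dotBl (F : pzRingType) n (x y z : 'rV[F]_n) :
  dot (x - y) z = dot x z - dot y z.
Proof. by rewrite /dot mulmxBl !mxE. Qed.

Lemma dotZl (F : pzRingType) n (t : F) (x y : 'rV[F]_n) :
  dot (t *: x) y = t * dot x y.
Proof. by rewrite /dot -scalemxAl mxE. Qed.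

Lemma dotC (F : comPzRingType) n (x y : 'rV[F]_n) : dot x y = dot y x.
Proof. by rewrite !dotE; apply: eq_bigr => i _; rewrite mulrC. Qed.

Lemma dot_row_mx (F : pzRingType) m n (x x' : 'rV[F]_m) (y y' : 'rV[F]_n) :
  dot (row_mx x y) (row_mx x' y') = dot x x' + dot y y'.
Proof. by rewrite /dot tr_row_mx mul_row_col mxE. Qed.

Lemma dot_const1 (F : pzRingType) (x y : F) :
  dot (const_mx x : 'rV_1) (const_mx y) = x * y.
Proof. by rewrite dotE big_ord1 !mxE. Qed.

Lemma dot_delta (F : pzRingType) n (x : 'rV[F]_n) i :
  dot x (delta_mx 0 i) = x 0 i.
Proof.
rewrite dotE (bigD1 i) //= mxE !eqxx mulr1 big1 ?addr0 // => j ji.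
by rewrite mxE (negbTE ji) andbF mulr0.
Qed.

Notation real_row := (map_mx (@ratr R)).

Lemma dot_real_row n (a b : 'rV[rat]_n) :
  dot (real_row a) (real_row b) = ratr (dot a b).
Proof. by rewrite /dot map_trmx -map_mxM mxE. Qed.

(** Peeling off one generator at a time lets the elimination of a generator be
the inductive step of the facet description. *)
Fixpoint cone n (s : seq 'rV[rat]_n) (x : 'rV[R]_n) : Prop :=
  if s is a :: s' then exists2 t, 0 <= t & cone s' (x - t *: real_row a)
  else x = 0.

Lemma cone0 n (s : seq 'rV[rat]_n) : cone s 0.
Proof. by elim: s => //= a s IH; exists 0; rewrite // scale0r subr0. Qed.

Lemma mem_cone n (s : seq 'rV[rat]_n) a : a \in s -> cone s (real_row a).
Proof.
elim: s => //= b s IH; rewrite inE => /orP[/eqP->|/IH cs].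
  by exists 1; rewrite ?ler01 // scale1r subrr; apply: cone0.
by exists 0; rewrite // scale0r subr0.
Qed.

(** Each constraint [t * u <= v] bounds [t] from above or from below according
to the sign of [u]; with [0 <= t] the system is solvable as soon as every lower
bound is below every upper bound. *)
Lemma eliminate_scalar (I : eqType) (B : seq I) (u v : I -> R) :
  (forall b, b \in B -> 0 <= u b -> 0 <= v b) ->
  (forall b b', b \in B -> b' \in B -> 0 < u b -> u b' < 0 ->
     0 <= u b * v b' - u b' * v b) ->
  exists2 t, 0 <= t & forall b, b \in B -> t * u b <= v b.
Proof.
move=> vpos vcross.
(* the largest of the lower bounds *)
exists (\big[Num.max/0]_(b <- B | u b < 0) (v b / u b)).
  exact: bigmax_ge_id.
move=> b bB; have [ub|ub|ub] := ltgtP (u b) 0.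
- by rewrite -ler_ndivrMr //; exact: (le_bigmax_seq 0 b _ (fun b => v b / u b)).
- rewrite -ler_pdivlMr // big_seq_cond; apply: bigmax_le => [|b' /andP[b'B ub']].
    by rewrite divr_ge0 ?vpos // ltW.
  rewrite ler_ndivrMr // mulrAC ler_pdivrMr //.
  by move: (vcross _ _ bB b'B ub ub'); lra.
- by rewrite ub mulr0 vpos // ub.
Qed.

(** Adding a generator [a] replaces [x] by [x - t a] with an unknown [0 <= t].
Fourier-Motzkin elimination of [t] keeps the constraints that are nonnegative
on [a] and combines the others pairwise into constraints vanishing on [a]. The
combinations have rational coefficients, although [x] is real. *)
Lemma finitely_constrained_cone n (s : seq 'rV[rat]_n) :
  exists B : seq 'rV[rat]_n, forall x,
    cone s x <-> forall b, b \in B -> 0 <= dot (real_row b) x.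
Proof.
elim: s => [|a s [B HB]].
  exists ([seq delta_mx 0 i | i <- enum 'I_n] ++
          [seq - delta_mx 0 i | i <- enum 'I_n]) => x; split=> [-> b _|xB].
    by rewrite dot0r.
  apply/rowP=> i; rewrite mxE; apply/eqP; rewrite eq_le.
  have xi b : b \in [:: delta_mx 0 i; - delta_mx 0 i] ->
      0 <= dot (real_row b) x.
    rewrite !inE => bi; apply: xB; rewrite mem_cat; apply/orP.
    case/orP: bi => /eqP->; [left|right]; apply/mapP; exists i => //;
    by rewrite mem_enum.
  have := xi _ (mem_head _ _); have := xi _ (mem_last _ _) => /=.
  rewrite map_mxN map_delta_mx -scaleN1r dotZl dotC dot_delta mulN1r oppr_ge0.
  by move=> -> ->.
exists ([seq b <- B | 0 <= dot b a] ++
  [seq dot b a *: b' - dot b' a *: b | b <- [seq b <- B | 0 < dot b a],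
                                       b' <- [seq b <- B | dot b a < 0]]) => x.
split=> [/=[t t0 /HB xB] b|xB].
  have {}xB c : c \in B -> t * ratr (dot c a) <= dot (real_row c) x.
    move/xB; rewrite [X in _ <= X]dotC dotBl dotZl dotC -dot_real_row subr_ge0.
    by rewrite [X in t * X]dotC.
  rewrite mem_cat => /orP[|/allpairsP[[c d] /=]].
    rewrite mem_filter => /andP[ba /xB]; apply: le_trans.
    by rewrite mulr_ge0 // ler0q.
  rewrite !mem_filter => -[/andP[ca cB] /andP[da dB] ->].
  rewrite map_mxD map_mxN !map_mxZ dotBl !dotZl.
  have ca' : 0 < ratr (dot c a) :> R by rewrite ltr0q.
  have da' : ratr (dot d a) < 0 :> R by rewrite ltrq0.
  move: (xB _ cB) (xB _ dB) => xc xd; nra.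
have [|b b' bB b'B|t t0 xt] :=
  @eliminate_scalar _ B (fun b => ratr (dot b a)) (fun b => dot (real_row b) x).
- move=> b bB; rewrite ler0q => ba; apply: xB.
  by rewrite mem_cat mem_filter ba bB.
- rewrite ltr0q ltrq0 => ba b'a.
  rewrite -!dotZl -dotBl -!map_mxZ -map_mxB; apply: xB.
  rewrite mem_cat; apply/orP; right; apply/allpairsP; exists (b, b').
  by rewrite !mem_filter ba b'a bB b'B.
exists t => //=; apply/HB => b bB; rewrite dotC dotBl dotZl subr_ge0.
by rewrite dotC dot_real_row (dotC x) xt.
Qed.

(** A nonnegative combination of nonnegative numbers vanishes only if each term
does: on the face [phi = 0] of the cone only generators of that face occur, and
one of them accounts for the positive value of [psi]. *)
Lemma cone_face n (s : seq 'rV[rat]_n) (phi psi x : 'rV[R]_n) :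
    (forall a, a \in s -> 0 <= dot (real_row a) phi) ->
    cone s x -> dot x phi = 0 -> 0 < dot x psi ->
  exists2 a, a \in s & dot (real_row a) phi = 0 /\ 0 < dot (real_row a) psi.
Proof.
have cone_ge0 r y : (forall a, a \in r -> 0 <= dot (real_row a) phi) ->
    cone r y -> 0 <= dot y phi.
  elim: r y => [|a r IH] y phi0 /=; first by move=> ->; rewrite dot0l.
  move=> [t t0 /IH yr]; have {yr} : 0 <= dot (y - t *: real_row a) phi.
    by apply: yr => b br; apply: phi0; rewrite inE br orbT.
  have := phi0 _ (mem_head _ _); rewrite dotBl dotZl; nra.
elim: s x => [|a s IH] x phi0 /=; first by move=> ->; rewrite !dot0l ltxx.
move=> [t t0 xs]; have phia := phi0 _ (mem_head _ _).
have {}phi0 b : b \in s -> 0 <= dot (real_row b) phi.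
  by move=> bs; apply: phi0; rewrite inE bs orbT.
have := cone_ge0 _ _ phi0 xs; move: (IH _ phi0 xs); rewrite !dotBl !dotZl.
move=> {}IH y0 xphi xpsi.
have ta : t * dot (real_row a) phi = 0 by move: y0; nra.
have [xa|xa] := ltP 0 (dot x psi - t * dot (real_row a) psi).
  have [|b bs bP] := IH _ xa; first by rewrite xphi ta subr0.
  by exists b; rewrite // inE bs orbT.
have tpos : 0 < t * dot (real_row a) psi by lra.
exists a; first exact: mem_head; move/eqP: ta; rewrite mulf_eq0.
have tn0 : t != 0 by apply: contraTneq tpos => ->; rewrite mul0r ltxx.
rewrite (negbTE tn0) => /eqP ->; split=> //.
by rewrite -(pmulr_rgt0 _ (_ : 0 < t)) // lt_def tn0.
Qed.

End RationalCones.

(** * The diagram below finitely many exponents *)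

Section Diagram.
Variable R : realType.

Definition natr_row (F : pzSemiRingType) n (a : 'rV[nat]_n) : 'rV[F]_n :=
  map_mx (fun m => m%:R) a.

Lemma pairingE (w nu : 'rV[R]_3) : pairing w nu = dot nu w.
Proof. by rewrite dotC dotE. Qed.

Lemma real_row_natr n (a : 'rV[nat]_n) :
  map_mx (@ratr R) (natr_row rat a) = natr_row R a.
Proof. by apply/rowP => i; rewrite !mxE ratr_nat. Qed.

Definition axis_point (N : nat) (i : 'I_3) : 'rV[nat]_3 :=
  \row_j (if j == i then N else 0%N).

(** Points are placed at height [1] and directions at height [0], so that the
polyhedron spanned by points and directions becomes a cone. *)
Definition homogenize (F : fieldType) (x : 'rV[F]_3) (c : F) : 'rV[F]_(3 + 1) :=
  row_mx x (const_mx c).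

Lemma dot_homogenize (F : fieldType) (x y : 'rV[F]_3) (c d : F) :
  dot (homogenize x c) (homogenize y d) = dot x y + c * d.
Proof. by rewrite dot_row_mx dot_const1. Qed.

Lemma homogenizeK (F : fieldType) (b : 'rV[F]_(3 + 1)) :
  b = homogenize (lsubmx b) (rsubmx b 0 0).
Proof.
rewrite -[LHS]hsubmxK /homogenize; congr row_mx.
by apply/rowP => i; rewrite ord1 [RHS]mxE.
Qed.

Lemma real_row_homogenize (x : 'rV[rat]_3) (c : rat) :
  map_mx (@ratr R) (homogenize x c) = homogenize (map_mx (@ratr R) x) (ratr c).
Proof. by rewrite /homogenize map_row_mx map_const_mx. Qed.

Lemma pairing_axis (w : 'rV[R]_3) N i :
  pairing w (natr_row R (axis_point N i)) = w 0 i * N%:R.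
Proof.
rewrite /pairing (bigD1 i) //= !mxE eqxx big1 ?addr0 // => j ji.
by rewrite !mxE (negbTE ji) mulr0.
Qed.

(** The constraints of the cone over the convex hull of [A] plus the orthant are
[l + d >= 0] with [l >= 0]. Those with [d >= 0] hold on the orthant; when
[d < 0], the points on the axes force [l > 0], and [l / (- d)] is normalised to
the value [1]. So the resulting forms cut out exactly this polyhedron. Its
points being combinations of [A] and of directions, a weight [v] that attains
its minimum over [A] at one of them attains it at points of [A] as well, and
these cover every coordinate in which [nu] and [v] are positive. *)
Lemma newton_diagram (A : seq 'rV[nat]_3) (N : nat) :
    (forall i, axis_point N i \in A) ->
    (forall a, a \in A -> exists i, (0 < a 0%R i)%N) ->
  exists J : {fset 'rV[rat]_3}, [/\ cface_family J,
    forall a l, a \in A -> l \in J ->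
      1 <= pairing (real_weight R l) (natr_row R a)
  & forall (nu : 'rV[R]_3), orthant nu ->
      (forall l, l \in J -> 1 <= pairing (real_weight R l) nu) ->
    forall (v : 'rV[R]_3) c, (forall i, 0 <= v 0 i) ->
      (forall a, a \in A -> c <= pairing v (natr_row R a)) ->
      pairing v nu = c ->
    (exists2 a, a \in A & pairing v (natr_row R a) = c) /\
    (forall j, 0 < v 0 j -> 0 < nu 0 j ->
       exists2 a, a \in A & pairing v (natr_row R a) = c /\ (0 < a 0%R j)%N)].
Proof.
move=> Aaxis An0.
pose s := [seq homogenize (natr_row rat a) 1 | a <- A] ++
          [seq homogenize (delta_mx 0 i) 0 | i <- enum 'I_3].
have [B HB] := finitely_constrained_cone R s.
pose slope (b : 'rV[rat]_(3 + 1)) : 'rV[rat]_3 := lsubmx b.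
pose const (b : 'rV[rat]_(3 + 1)) := rsubmx b 0 0.
have sA a : a \in A -> homogenize (natr_row rat a) 1 \in s.
  by move=> aA; rewrite mem_cat; apply/orP; left; apply/mapP; exists a.
have sE i : homogenize (delta_mx 0 i) 0 \in s.
  by rewrite mem_cat; apply/orP; right; apply/mapP; exists i; rewrite ?mem_enum.
have Bs b x : b \in B -> x \in s -> 0 <= dot b x.
  move=> bB xs; rewrite -(ler0q R) -dot_real_row.
  by have /HB := mem_cone R xs; apply.
have BA b a : b \in B -> a \in A -> 0 <= dot (slope b) (natr_row rat a) + const b.
  move=> bB aA; have := Bs _ _ bB (sA _ aA).
  by rewrite [b in dot b]homogenizeK dot_homogenize mulr1.
have B0 b i : b \in B -> 0 <= slope b 0 i.
  move=> bB; have := Bs _ _ bB (sE i).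
  by rewrite [b in dot b]homogenizeK dot_homogenize mulr0 addr0 dot_delta.
pose form b := (- const b)^-1 *: slope b.
(* The sum of the coordinates is at least 1 on nonzero natural exponents; it
   makes the family nonempty. *)
exists [fset l in const_mx 1 :: [seq form b | b <- B & const b < 0]]%fset.
split.
- split; first by exists (const_mx 1); rewrite !inE eqxx.
  move=> l; rewrite !inE => /orP[/eqP-> i|]; first by rewrite mxE ltr01.
  move=> /mapP[b]; rewrite mem_filter => /andP[cb bB] -> i.
  rewrite mxE mulr_gt0 ?invr_gt0 ?oppr_gt0 //.
  have := BA b _ bB (Aaxis i); rewrite dotC dotE (bigD1 i) //= big1.
    rewrite addr0 [natr_row _ _ _ _]mxE mxE eqxx => H; have := B0 b i bB.
    rewrite le_eqVlt => /orP[/eqP sb|//].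
    by move: H; rewrite -sb mulr0; lra.
  by move=> j ji; rewrite !mxE (negbTE ji) mul0r.
- move=> a l aA; rewrite !inE => /orP[/eqP->|].
    have [i ai] := An0 _ aA; rewrite /pairing (bigD1 i) //= !mxE rmorph1 mul1r.
    rewrite ler_wpDr ?ler1n // sumr_ge0 // => j _.
    by rewrite !mxE rmorph1 mul1r ler0n.
  move=> /mapP[b]; rewrite mem_filter => /andP[cb bB] ->.
  rewrite pairingE -real_row_natr dot_real_row -(rmorph1 (@ratr R)) ler_rat.
  rewrite dotC dotZl mulrC ler_pdivlMr ?oppr_gt0 // mul1r.
  by rewrite -subr_ge0 opprK; apply: BA.
- move=> nu nu0 nuJ v c v0 vA vnu.
  have nus : cone s (homogenize nu 1).
    apply/HB => b bB; rewrite [b]homogenizeK real_row_homogenize.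
    rewrite dot_homogenize mulr1 -/(slope b) -/(const b).
    have [cb|cb] := ltP (const b) 0; last first.
      rewrite addr_ge0 ?ler0q // dotE sumr_ge0 // => i _.
      by rewrite mulr_ge0 ?nu0 // mxE ler0q; apply: B0.
    have /nuJ : form b \in
        [fset l in const_mx 1 :: [seq form b | b <- B & const b < 0]]%fset.
      by rewrite !inE map_f ?orbT // mem_filter cb.
    rewrite pairingE dotC /real_weight map_mxZ dotZl fmorphV rmorphN /=.
    have cb' : 0 < - ratr (const b) :> R by rewrite oppr_gt0 ltrq0.
    by rewrite mulrC ler_pdivlMr // mul1r; lra.
  have phis a : a \in s ->
      0 <= dot (map_mx (@ratr R) a) (homogenize v (- c)).
    rewrite mem_cat => /orP[] /mapP[x xP ->]; rewrite real_row_homogenize.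
      by rewrite dot_homogenize rmorph1 mul1r real_row_natr -pairingE subr_ge0 vA.
    by rewrite dot_homogenize rmorph0 mul0r addr0 map_delta_mx dotC dot_delta.
  have phinu : dot (homogenize nu 1) (homogenize v (- c)) = 0.
    by rewrite dot_homogenize mul1r -pairingE vnu subrr.
  split=> [|j vj nuj].
    have [|a] := cone_face (psi := homogenize 0 1) phis nus phinu.
      by rewrite dot_homogenize dot0r add0r mulr1 ltr01.
    rewrite mem_cat => /orP[] /mapP[x xP ->]; rewrite real_row_homogenize.
      rewrite !dot_homogenize rmorph1 mul1r real_row_natr -pairingE => -[xc _].
      by exists x => //; lra.
    by rewrite !dot_homogenize rmorph0 dot0r !mul0r !addr0 ltxx => -[].
  have [|a] := cone_face (psi := homogenize (delta_mx 0 j) 0) phis nus phinu.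
    by rewrite dot_homogenize dot_delta mulr0 addr0.
  rewrite mem_cat => /orP[] /mapP[x xP ->]; rewrite real_row_homogenize.
    rewrite !dot_homogenize rmorph1 mul1r real_row_natr -pairingE.
    rewrite mulr0 addr0 dot_delta mxE ltr0n => -[xc xj].
    by exists x => //; split=> //; lra.
  rewrite !dot_homogenize rmorph0 !mul0r !addr0 map_delta_mx dot_delta mxE.
  have [<-|jx] := eqVneq j x; last by rewrite andbF ltxx => -[].
  by rewrite dotC dot_delta => -[vj0]; rewrite vj0 ltxx in vj.
Qed.

End Diagram.

(** * Jacobians of real and mixed polynomial maps *)

Section Jacobians.
Variable R : realType.

(** The chain rule gives ['J G y = P *m 'J F (y *m P)]. It can be read off the
difference quotients, since [z *m P] is linear in [z]. *)
Lemma jacobian_rank_pullback n m (F G : 'rV[R]_n -> 'rV[R]_m) (P : 'M[R]_n) y :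
    differentiable F (y *m P) -> differentiable G y ->
    (forall z, G z = F (z *m P)) ->
  (\rank ('J G y) <= \rank ('J F (y *m P)))%N.
Proof.
move=> dF dG GF; suff -> : 'J G y = P *m 'J F (y *m P) by exact: mxrankM_maxr.
apply/row_matrixP => i; rewrite !rowE mulmxA.
rewrite -!deriveEjacobian // /derive.
by under eq_fun do rewrite /= !GF mulmxDl -scalemxAl.
Qed.

(** [F] is affine along each direction [u *m E], so its derivative there is the
slope; nonzero slopes make [E *m 'J F y] row free. *)
Lemma jacobian_rank_ge n m r (F : 'rV[R]_n -> 'rV[R]_m) (E : 'M[R]_(r, n)) y :
    differentiable F y ->
    (forall u, u != 0 -> exists2 L, L != 0 &
       forall t : R, F (y + t *: (u *m E)) = F y + t *: L) ->
  (r <= \rank ('J F y))%N.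
Proof.
move=> dF affF; suff /eqP <- : row_free (E *m 'J F y) by exact: mxrankM_maxr.
apply: inj_row_free => u; rewrite mulmxA -deriveEjacobian // => Du0.
apply/eqP/negP => /negP/affF[L Ln0 FL]; move/eqP: Ln0; apply.
rewrite -Du0; apply/esym; rewrite /derive.
apply: cvg_lim => //; apply: cvg_near_cst; near=> h.
rewrite /= [X in F X]addrC FL [F y + _]addrC addrK scalerA mulVf ?scale1r //.
by near: h; apply: nbhs_dnbhs_neq.
Unshelve. all: by end_near. Qed.

(** Used with the real differentiable functions and with the complex functions
that have differentiable real and imaginary parts. *)
Lemma meval_closed (V : Type) (K : comNzRingType) n (P : (V -> K) -> Prop)
    (v : V -> 'I_n -> K) (f : {mpoly K[n]}) :
    (forall c, P (fun=> c)) ->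
    (forall g h, P g -> P h -> P (fun x => g x + h x)) ->
    (forall g h, P g -> P h -> P (fun x => g x * h x)) ->
    (forall i, P (fun x => v x i)) ->
  P (fun x => f.@[v x]).
Proof.
move=> Pc PD PM Pv.
have PX i d : P (fun x => v x i ^+ d).
  elim: d => [|d IH]; first by under eq_fun do rewrite expr0; apply: Pc.
  by under eq_fun do rewrite exprS; apply: PM.
elim/mpolyind: f => [|c m f _ _ IH].
  by under eq_fun do rewrite meval0; apply: Pc.
under eq_fun do rewrite mevalD mevalZ mevalX.
apply: (PD) => //; apply: (PM) => //; elim: (index_enum _) => [|i s IHs].
  by under eq_fun do rewrite big_nil; apply: Pc.
by under eq_fun do rewrite big_cons; apply: PM.
Qed.

Lemma real_map_differentiable (f : polyfun R RealField) y :
  differentiable (real_map f) y.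
Proof.
have -> : real_map f = fun z => (evalf f z : R) *: const_mx 1.
  by apply/funext => z; apply/rowP => i; rewrite !mxE mulr1.
apply: differentiableZl.
apply: (@meval_closed _ R 3 (fun g => differentiable (g : 'rV[R]_3 -> R) y)
  (fun x i => x 0 i)).
- by move=> c; apply: differentiable_cst.
- by move=> g h; apply: differentiableD.
- by move=> g h; apply: differentiableM.
- by move=> i; apply: differentiable_coord.
Qed.

Lemma mixed_map_differentiable (f : polyfun R ComplexField) y :
  differentiable (mixed_map f) y.
Proof.
pose P (g : 'rV[R]_(3 + 3) -> R[i]) :=
  differentiable (fun z => complex.Re (g z) : R) y /\
  differentiable (fun z => complex.Im (g z) : R) y.
have -> : mixed_map f = fun z =>
    (complex.Re (evalf f (of_real z)) *: row_mx (const_mx 1) 0 +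
     complex.Im (evalf f (of_real z)) *: row_mx 0 (const_mx 1)).
  apply/funext => z; rewrite /mixed_map !scale_row_mx add_row_mx !scaler0.
  by rewrite addr0 add0r; congr row_mx; apply/rowP => i; rewrite !mxE mulr1.
suff [? ?] : P (fun z => evalf f (of_real z)).
  by apply: differentiableD; apply: differentiableZl.
apply: (@meval_closed _ (ground_field R ComplexField) (nvars ComplexField) P
  (fun z => @var_values R ComplexField (of_real z)) f).
- by move=> c; split; apply: differentiable_cst.
- move=> g h [g1 g2] [h1 h2]; split.
    have -> : (fun z => complex.Re (g z + h z)) =
      (fun z => complex.Re (g z)) + (fun z => complex.Re (h z)).
      by apply/funext => z; rewrite raddfD.
    exact: differentiableD.
  have -> : (fun z => complex.Im (g z + h z)) =
      (fun z => complex.Im (g z)) + (fun z => complex.Im (h z)).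
    by apply/funext => z; rewrite raddfD.
  exact: differentiableD.
- move=> g h [g1 g2] [h1 h2]; split.
    have -> : (fun z => complex.Re (g z * h z)) =
      (fun z => complex.Re (g z)) * (fun z => complex.Re (h z)) -
      (fun z => complex.Im (g z)) * (fun z => complex.Im (h z)).
      by apply/funext => z; rewrite !fctE; case: (g z) => ? ?; case: (h z).
    by apply: differentiableB; apply: differentiableM.
  have -> : (fun z => complex.Im (g z * h z)) =
      (fun z => complex.Re (g z)) * (fun z => complex.Im (h z)) +
      (fun z => complex.Im (g z)) * (fun z => complex.Re (h z)).
    by apply/funext => z; rewrite !fctE; case: (g z) => ? ?; case: (h z).
  by apply: differentiableD; apply: differentiableM.
- move=> i; rewrite /P /= /var_values; case: fintype.split => j; split.
  + by under eq_fun do rewrite mxE /=; apply: differentiable_coord.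
  + by under eq_fun do rewrite mxE /=; apply: differentiable_coord.
  + by under eq_fun do rewrite mxE /=; apply: differentiable_coord.
  + under eq_fun do rewrite mxE /=.
    by apply: differentiableN; apply: differentiable_coord.
Qed.

End Jacobians.

(** * Real rescalings of the coordinates *)

Section Evaluation.
Variable R : realType.

Definition real_scalar (k : base_field) : R -> ground_field R k :=
  match k return R -> ground_field R k with
  | RealField => fun t => t
  | ComplexField => fun t => (t%:C)%C
  end.

(** The exponent [nu] of a real monomial, and [nu + mu] of a mixed one, kept as
natural numbers. *)
Definition expo (k : base_field) : 'X_{1..nvars k} -> 'rV[nat]_3 :=
  match k return 'X_{1..nvars k} -> 'rV[nat]_3 with
  | RealField => fun m : 'X_{1..3} => \row_i m i
  | ComplexField => fun m : 'X_{1..3 + 3} =>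
      \row_i (m (lshift 3 i) + m (rshift 3 i))%N
  end.

Lemma exponent_vecE k (m : 'X_{1..nvars k}) :
  exponent_vec R m = natr_row R (expo m).
Proof. by case: k m => m; apply/rowP => i; rewrite !mxE. Qed.

Definition monomial (k : base_field) (m : 'X_{1..nvars k})
  (x : 'rV[ground_field R k]_3) := \prod_i var_values x i ^+ m i.

Lemma evalf_part k (f : polyfun R k) (A : set 'rV[R]_3) x :
  evalf (part f A) x =
  \sum_(m <- msupp f | `[< A (exponent_vec R m) >]) f@_m * monomial m x.
Proof.
rewrite /evalf /part (raddf_sum (meval (var_values x))).
by apply: eq_bigr => m _; rewrite /= mevalZ mevalX.
Qed.

Definition rescale (k : base_field) (s : 'I_3 -> R) (x : 'rV[ground_field R k]_3)
  : 'rV[ground_field R k]_3 := \row_i (real_scalar k (s i) * x 0 i).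

Lemma real_scalar0 k : real_scalar k 0 = 0.
Proof. by case: k. Qed.

Lemma real_scalar1 k : real_scalar k 1 = 1.
Proof. by case: k. Qed.

(** Conjugation fixes real factors, so a mixed monomial is homogeneous of degree
[nu + mu] for real rescalings. Projections onto coordinate subspaces and motions
along one coordinate are such rescalings, which treats both fields at once. *)
Lemma monomial_rescale k (m : 'X_{1..nvars k}) s x :
  monomial m (rescale s x) =
  real_scalar k (\prod_i s i ^+ expo m 0%R i) * monomial m x.
Proof.
case: k m x => m x; rewrite /monomial /=.
  rewrite -big_split /=; apply: eq_bigr => i _.
  by rewrite /rescale !mxE exprMn.
rewrite (big_split_ord _ (m := 3)) [X in _ = _ * X](big_split_ord _ (m := 3)) /=.
under [X in X * _ = _]eq_bigr => i _.
  rewrite (unsplitK (inl i)) mxE exprMn /=; over.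
under [X in _ * X = _]eq_bigr => i _.
  rewrite (unsplitK (inr i)) mxE rmorphM exprMn /=; over.
under [X in _ = _ * (X * _)]eq_bigr do rewrite (unsplitK (inl _)).
under [X in _ = _ * (_ * X)]eq_bigr do rewrite (unsplitK (inr _)).
rewrite !big_split /= mulrACA; congr (_ * _).
rewrite -big_split /= rmorph_prod; apply: eq_bigr => i _.
rewrite mxE exprD rmorphM !rmorphXn /=; congr (_ * _ ^+ _).
by apply/eqP; rewrite eq_complex /= oppr0 !eqxx.
Qed.

Lemma to_realK (x : 'rV[R[i]]_3) : of_real (to_real x) = x.
Proof.
apply/rowP => i; rewrite !mxE (unsplitK (inl i)) (unsplitK (inr i)) !mxE.
by case: (x 0 i).
Qed.

Lemma of_realK (y : 'rV[R]_(3 + 3)) : to_real (of_real y) = y.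
Proof.
by rewrite -[RHS]hsubmxK; congr row_mx; apply/rowP => i; rewrite !mxE.
Qed.

(** A rescaling is a real-linear map, so composing with it can only lower the
rank of the real Jacobian. *)
Lemma sing_pullback k (f g : polyfun R k) s x :
    (forall y, evalf g y = evalf f (rescale s y)) ->
  sing f (rescale s x) -> sing g x.
Proof.
case: k f g x => f g x gf /=; apply: leq_ltn_trans.
  have sE z : @rescale RealField s z = z *m diag_mx (\row_i s i).
    by rewrite mul_mx_diag; apply/rowP => i; rewrite !mxE mulrC.
  rewrite sE; apply: jacobian_rank_pullback => [||z].
  - exact: real_map_differentiable.
  - exact: real_map_differentiable.
  - by rewrite /real_map gf sE.
pose P : 'M[R]_(3 + 3) := diag_mx (row_mx (\row_i s i) (\row_i s i)).
have sE z : @rescale ComplexField s (of_real z) = of_real (z *m P).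
  rewrite /P mul_mx_diag; apply/rowP => i; rewrite !mxE.
  rewrite (unsplitK (inl i)) (unsplitK (inr i)) /= !mxE.
  by apply/eqP; rewrite eq_complex /= !mul0r subr0 addr0 ![s i * _]mulrC !eqxx.
have to_realE : to_real (@rescale ComplexField s x) = to_real x *m P.
  by rewrite -[in LHS](to_realK x) sE of_realK.
rewrite to_realE; apply: jacobian_rank_pullback => [||z].
- exact: mixed_map_differentiable.
- exact: mixed_map_differentiable.
- by rewrite /mixed_map gf sE.
Qed.

(** The slopes [L] are the values of the derivative on the real directions
[v e_j]. As none vanishes, the derivative is injective on a space of the real
dimension of [K], hence onto [K]. *)
Lemma nonsing_affine k (f : polyfun R k) j x :
    (forall v, v != 0 -> exists2 L, L != 0 & forall t : R,
       evalf f (x + (real_scalar k t * v) *: delta_mx 0 j) =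
       evalf f x + real_scalar k t * L) ->
  ~ sing f x.
Proof.
case: k f x => f x affF /=; apply/negP; rewrite -leqNgt.
  apply: (jacobian_rank_ge (E := delta_mx 0 j)) => [|u u0].
    exact: real_map_differentiable.
  have [|L L0 fL] := affF (u 0 0).
    by apply: contraNneq u0 => u0; apply/eqP/rowP => i; rewrite ord1 mxE.
  exists (const_mx L) => [|t].
    by apply: contraNneq L0 => /rowP/(_ 0); rewrite !mxE => ->.
  have -> : u *m delta_mx 0 j = u 0 0 *: delta_mx 0 j :> 'rV[R]_3.
    by rewrite [u in u *m _]mx11_scalar mul_scalar_mx.
  by rewrite scalerA; apply/rowP => i; rewrite /real_map !mxE fL.
pose d : 'rV[R]_3 := delta_mx 0 j.
apply: (jacobian_rank_ge (E := block_mx d 0 0 d)) => [|u u0].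
  exact: mixed_map_differentiable.
pose a := lsubmx u 0 0; pose b := rsubmx u 0 0.
have uE : u = row_mx (const_mx a) (const_mx b).
  by rewrite -[LHS]hsubmxK; congr row_mx; apply/rowP => i; rewrite ord1 [RHS]mxE.
have [|L L0 fL] := affF (a +i* b)%C.
  apply: contraNneq u0 => -[a0 b0]; rewrite uE a0 b0.
  by apply/eqP/rowP => i; rewrite !mxE; case: splitP => ? _; rewrite mxE.
exists (row_mx (const_mx (complex.Re L)) (const_mx (complex.Im L))) => [|t].
  apply: contraNneq L0 => /eqP; rewrite row_mx_eq0.
  move=> /andP[/eqP/rowP/(_ 0) + /eqP/rowP/(_ 0)].
  by rewrite !mxE; case: (L) => p q /= -> ->.
have ofE : of_real (to_real x + t *: (u *m block_mx d 0 0 d)) =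
   x + (real_scalar ComplexField t * (a +i* b)%C) *: delta_mx 0 j.
  apply/rowP => i; rewrite uE mul_row_block !mulmx0 addr0 add0r !mxE.
  rewrite !(unsplitK (inl i)) !(unsplitK (inr i)) !mxE !big_ord1 !mxE.
  by apply/eqP; rewrite eq_complex /=; case: (x 0 i) (i == j) => p q [] /=;
    rewrite !(mulr1, mulr0, mul0r, subr0, addr0, add0r) !eqxx.
rewrite /mixed_map ofE fL to_realK scale_row_mx add_row_mx.
by congr row_mx; apply/rowP => i; rewrite !mxE raddfD /=; case: (L) => p q /=;
  rewrite !mul0r ?subr0 ?addr0.
Qed.

End Evaluation.

(** * Weights and the Newton boundary *)

Section Weights.
Variable R : realType.

Lemma pairingDl (w w' nu : 'rV[R]_3) :
  pairing (w + w') nu = pairing w nu + pairing w' nu.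
Proof. by rewrite -big_split; apply: eq_bigr => i _; rewrite mxE mulrDl. Qed.

Lemma pairingZl c (w nu : 'rV[R]_3) : pairing (c *: w) nu = c * pairing w nu.
Proof. by rewrite /pairing mulr_sumr; apply: eq_bigr => i _; rewrite mxE mulrA. Qed.

Lemma pairingC (w nu : 'rV[R]_3) : pairing w nu = pairing nu w.
Proof. by apply: eq_bigr => i _; rewrite mulrC. Qed.

Lemma pairing_delta (w : 'rV[R]_3) i : pairing w (delta_mx 0 i) = w 0 i.
Proof. by rewrite pairingE dotC dot_delta. Qed.

(** If [S] had such a point below [p], the normal of any face through [p] would be
nonpositive on [e_i]; the face would then contain the ray [p + s e_i], and could
not be compact. *)
Lemma newton_boundary_minimal (S : set 'rV[R]_3) p i t :
  S p -> newton_boundary S p -> 0 < t -> ~ S (p - t *: delta_mx 0 i).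
Proof.
move=> Sp [F [cF [a Fa]] Fp] t0 Sq; rewrite Fa in Fp.
have inP q x : S q -> orthant x -> newton_polyhedron S (q + x).
  by move=> Sq' x0; apply: sub_gen_smallest; exists q => //; exists x.
have ai : a 0 i <= 0.
  have /Fp.2 : newton_polyhedron S (p - t *: delta_mx 0 i).
    by rewrite -[X in newton_polyhedron S X]addr0; apply: inP => // l; rewrite mxE.
  rewrite pairingC (pairingC _ (_ - _)) pairingDl -scaleNr pairingZl.
  by rewrite (pairingC (delta_mx 0 i)) pairing_delta; nra.
have ray s : 0 <= s -> F (p + s *: delta_mx 0 i).
  move=> s0; rewrite Fa; split.
    apply: inP => // l; rewrite !mxE.
    by rewrite mulr_ge0 // ler0n.
  move=> nu' /Fp.2; apply: le_trans.
  rewrite pairingC pairingDl pairingZl pairingC (pairingC (delta_mx 0 i)).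
  by rewrite pairing_delta; nra.
have [M [_ MF]] := compact_bounded cF.
have : `|p + (`|p| + `|M| + 2) *: delta_mx 0 i| <= `|M| + 1.
  apply: MF; first by rewrite (le_lt_trans (ler_norm M)) // ltrDl.
  by apply: ray; rewrite !addr_ge0.
have coord_le (x : 'rV[R]_3) : `|x 0 i| <= `|x|.
  by rewrite [leRHS]/Num.norm/= mx_normrE (le_trans _ (le_bigmax _ _ (0, i))).
have := coord_le (p + (`|p| + `|M| + 2) *: delta_mx 0 i).
have := coord_le p; rewrite !mxE !eqxx mulr1 => pi ple; apply/negP; rewrite -ltNge.
apply: lt_le_trans ple; rewrite (lt_le_trans _ (ler_norm _)) //.
by have := lerNnormlW (lexx `|p 0 i|); lra.
Qed.

(** KND is about natural weights, whereas faces of a diagram have rational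
ones. *)
Lemma integral_multiple (w : 'rV[rat]_3) : positive_weight w ->
  exists n : 'rV[nat]_3, (forall i, (0 < n 0%R i)%N) /\
    exists2 c : R, 0 < c & natr_row R n = c *: real_weight R w.
Proof.
move=> w0; pose den : int := \prod_i denq (w 0 i).
have den0 : 0 < den by apply: prodr_gt0 => i _; apply: denq_gt0.
pose num i : int := numq (w 0 i) * \prod_(j | j != i) denq (w 0 j).
have num0 i : 0 < num i.
  by rewrite mulr_gt0 ?numq_gt0 ?w0 // prodr_gt0 // => j _; apply: denq_gt0.
have numE i : (num i)%:~R = den%:~R * w 0 i :> rat.
  have -> : den = denq (w 0 i) * \prod_(j | j != i) denq (w 0 j).
    exact: bigD1.
  rewrite /num !intrM numqE; ring.
exists (\row_i `|num i|%N); split=> [i|].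
  by rewrite mxE absz_gt0 gt_eqF.
exists (ratr den%:~R); first by rewrite ltr0q ltr0z.
apply/rowP => i; rewrite !mxE -rmorphM /= -numE ratr_int.
by rewrite -[num i in RHS]gtz0_abs // natz.
Qed.

Lemma min_locus_scale c (w : 'rV[R]_3) S : 0 < c ->
  min_locus (c *: w) S = min_locus w S.
Proof.
move=> c0; apply/seteqP; split=> nu [Snu minnu]; split=> // nu' /minnu.
  by rewrite !pairingZl ler_pM2l.
by rewrite !pairingZl ler_pM2l.
Qed.

(** The representative is chosen from the face alone, so weights supporting the
same face get the same one. *)
Lemma face_weights_exist (D : set 'rV[R]_3) : exists P, face_weights D P.
Proof.
pose rep (F : set 'rV[R]_3) : set 'rV[rat]_3 :=
  [set w | positive_weight w /\ min_locus (real_weight R w) D = F].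
pose choice F := xget 0 (rep F).
exists [set choice F | F in [set F | has_dim 2 F /\ rep F !=set0]]; split.
  move=> _ [F [dimF [w0 repw]] <-].
  by have [? Fw] : rep F (choice F) := xgetI _ repw; rewrite Fw.
move=> w w0 dimw; set F := min_locus (real_weight R w) D.
have repF : rep F w by [].
have [? chF] : rep F (choice F) := xgetI _ repF.
exists (choice F); split=> [|w' [[F' [_ [w2 repw2]] <-]]].
  by split=> //; exists F => //; split=> //; exists w.
by have [_ ->] : rep F' (choice F') := xgetI _ repw2; move=> ->.
Qed.

End Weights.

(** * Inner faces of a diagram *)

Section Faces.
Variable R : realType.
Implicit Types (J : {fset 'rV[rat]_3}) (Delta : set 'rV[R]_3).

Lemma pairing_sum (I : Type) (s : seq I) (F : I -> 'rV[R]_3) nu :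
  pairing (\sum_(l <- s) F l) nu = \sum_(l <- s) pairing (F l) nu.
Proof.
elim: s => [|a s IH]; last by rewrite !big_cons pairingDl IH.
by rewrite !big_nil pairingE dot0r.
Qed.

Definition above J : set 'rV[R]_3 :=
  [set nu | orthant nu /\ forall l, l \in J -> 1 <= pairing (real_weight R l) nu].

(** An inner face imposes no vanishing coordinate, so it is given by equalities
[l = 1] for [l] in a subfamily. Since [l >= 1] above the diagram, these hold
together exactly when the sum of the subfamily is minimal. *)
Lemma inner_face_weight J Delta :
    cface_family J -> cface_face J Delta -> inner Delta ->
  exists (w : 'rV[rat]_3) (c : R), [/\ positive_weight w, Delta `<=` above J
    & forall nu, above J nu -> c <= pairing (real_weight R w) nu /\
                 (Delta nu <-> pairing (real_weight R w) nu = c)].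
Proof.
move=> [_ Jpos] [_ [I [J' [[l0 l0J'] J'J defDelta]]]] inD.
have IT : I = [set: 'I_3]%SET.
  by apply/eqP/negP => /negP/inD; apply; rewrite defDelta => nu [].
exists (\sum_(l <- enum_fset J') l), (\sum_(l <- enum_fset J') 1); split.
- move=> i; rewrite summxE (big_rem l0) //= ltr_pwDl ?Jpos ?J'J //.
  by rewrite big_seq sumr_ge0 // => l /mem_rem lJ'; rewrite ltW ?Jpos ?J'J.
- by move=> nu; rewrite defDelta => -[[nu0 [nuJ _]] _ _].
move=> nu [nu0 nuJ].
rewrite /real_weight (raddf_sum (map_mx (@ratr R))) pairing_sum.
have term0 l : l \in J' -> 0 <= pairing (real_weight R l) nu - 1.
  by move=> lJ'; rewrite subr_ge0 nuJ // J'J.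
split.
  by rewrite big_seq [leRHS]big_seq ler_sum // => l /term0; rewrite subr_ge0.
split; first by rewrite defDelta => -[_ _ nuJ']; apply: eq_big_seq => l /nuJ'.
move/eqP; rewrite -subr_eq0 -sumrB big_seq psumr_eq0 => [/allP sum0|l]; last first.
  exact: term0.
have eq1 l : l \in J' -> pairing (real_weight R l) nu = 1.
  move=> lJ'; have := sum0 _ lJ'; rewrite /= lJ' /= subr_eq0.
  by move=> /eqP.
rewrite defDelta; split=> // [|i]; last by rewrite IT inE.
by split=> //; split=> //; exists l0; rewrite J'J // eq1.
Qed.

(** Shrinking a point above the diagram by the smallest value of a form of [J]
on it yields a point of the diagram, of no larger weight. *)
Lemma min_value_above J (S : set 'rV[R]_3) w :
    cface_family J -> positive_weight w -> S !=set0 -> S `<=` above J ->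
  min_value (real_weight R w) (cface_diagram J) <= min_value (real_weight R w) S.
Proof.
move=> [[l0 l0J] Jpos] w0 [s Ss] SJ; apply: lb_le_inf.
  by exists (pairing (real_weight R w) s), s.
move=> _ [nu /SJ[nu0 nuJ] <-].
pose h (l : 'rV[rat]_3) := pairing (real_weight R l) nu.
have [l1 l1J hmin] : exists2 l, l \in J & forall l', l' \in J -> h l <= h l'.
  have [l _ lmin] := @arg_minP _ R _ [` l0J]%fset predT (fun l => h (val l)) isT.
  by exists (val l) => [|l' l'J]; [exact: valP | exact: (lmin [` l'J]%fset)].
have h1 : 1 <= h l1 by apply: nuJ.
have h0 : 0 < h l1 by apply: lt_le_trans h1.
apply: (@le_trans _ _ (pairing (real_weight R w) ((h l1)^-1 *: nu))).
  apply: ge_inf; last first.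
    exists ((h l1)^-1 *: nu) => //; split=> [i|].
      by rewrite mxE mulr_ge0 ?invr_ge0 ?(ltW h0).
    split=> [l lJ|].
      by rewrite pairingC pairingZl pairingC mulrC ler_pdivlMr // mul1r hmin.
    by exists l1; rewrite pairingC pairingZl pairingC mulVf ?gt_eqF.
  exists 0 => _ [mu [mu0 _] <-]; apply: sumr_ge0 => i _.
  by rewrite mulr_ge0 // mxE ler0q ltW.
rewrite pairingC pairingZl pairingC ler_piMl ?invf_le1 //.
by apply: sumr_ge0 => i _; rewrite mulr_ge0 // mxE ler0q ltW.
Qed.

Lemma third_index (i j : 'I_3) : j != i ->
  exists k : 'I_3, [/\ k != i, k != j, forall l, [|| l == i, l == j | l == k]
    & forall F : 'I_3 -> R, \sum_l F l = F i + F j + F k].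
Proof.
move=> ji; have /cards1P[k ijk] : #|~: [set i; j]| == 1%N.
  by have := cardsC [set i; j]; rewrite card_ord cards2 eq_sym ji => -[c1]; apply/eqP.
have kP l : (l == k) = (l != i) && (l != j).
  by have /setP/(_ l) := ijk; rewrite !inE negb_or => <-.
have := kP k; rewrite eqxx => /esym/andP[ki kj]; exists k; split=> // [l|F].
  by rewrite kP; case: eqP => //=; case: eqP.
rewrite (bigD1 i) //= (bigD1 j) //= -addrA; congr (_ + (_ + _)).
by apply: big_pred1 => l; rewrite /= kP.
Qed.

(** With [k] the third index, the bounds on [p] and [q] read
[N w_i <= p_i w_i + w_j] and [N w_i <= q_i w_i + q_k w_k]. As all coordinates
are at most [M], this gives [M w_i < w_j], and [M w_i < w_k] because
[M + M * M < N]. Comparing [u] with [p] leaves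
[u_i w_i + (u_j - 1) w_j + u_k w_k <= p_i w_i], with right side at most [M w_i];
so [u_j = 1] and [u_k = 0]. *)
Lemma steep_weight (w : 'rV[R]_3) c (i j : 'I_3) (M N : nat)
    (p q u : 'rV[nat]_3) :
    j != i -> (forall l, 0 < w 0 l) -> ((M + 2) ^ 2 <= N)%N -> w 0 i * N%:R = c ->
    (forall l, p 0%R l <= M)%N -> (forall l, q 0%R l <= M)%N ->
    p 0 j = 1%N -> (forall l, l \notin [set i; j]%SET -> p 0 l = 0%N) ->
    q 0 j = 0%N ->
    c <= pairing w (natr_row R p) -> c <= pairing w (natr_row R q) ->
    pairing w (natr_row R u) = c -> (0 < u 0%R j)%N ->
  (u 0%R i <= p 0%R i)%N /\ forall l, l != i -> u 0 l = p 0 l.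
Proof.
move=> ji w0 MN <- pM qM pj pk qj.
have [k [ki kj ijk sum3]] := third_index ji.
have {}pk : p 0 k = 0%N by apply: pk; rewrite !inE negb_or ki kj.
rewrite /pairing !sum3 !mxE pj pk qj => cp cq cu uj.
have wi := w0 i; have wj := w0 j; have wk := w0 k.
have {}MN : (M%:R + 2) ^+ 2 <= N%:R :> R by rewrite -natrD -natrX ler_nat.
have M0 : 0 <= M%:R :> R by [].
have pi : (p 0 i)%:R <= M%:R :> R by rewrite ler_nat.
have qi : (q 0 i)%:R <= M%:R :> R by rewrite ler_nat.
have qk : (q 0 k)%:R <= M%:R :> R by rewrite ler_nat.
have ui : 0 <= (u 0 i)%:R :> R by [].
have wNM : w 0 i * ((M%:R + 2) ^+ 2) <= w 0 i * N%:R by rewrite ler_pM2l.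
have wpi : w 0 i * (p 0 i)%:R <= w 0 i * M%:R by rewrite ler_pM2l.
have wqi : w 0 i * (q 0 i)%:R <= w 0 i * M%:R by rewrite ler_pM2l.
have wqk : w 0 k * (q 0 k)%:R <= w 0 k * M%:R by rewrite ler_pM2l.
have wiM : 0 <= w 0 i * M%:R by rewrite mulr_ge0 // ltW.
have wui : 0 <= w 0 i * (u 0 i)%:R by rewrite mulr_ge0 // ltW.
have wuk : 0 <= w 0 k * (u 0 k)%:R by rewrite mulr_ge0 // ltW.
have wjbig : w 0 i * M%:R < w 0 j by nra.
have wkbig : w 0 i * M%:R < w 0 k.
  rewrite ltNge; apply/negP => wks.
  have : w 0 k * M%:R <= w 0 i * M%:R * M%:R by rewrite ler_wpM2r.
  nra.
have uj1 : 1 <= (u 0 j)%:R :> R by rewrite ler1n.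
have ujE : u 0 j = 1%N.
  apply/eqP; rewrite eqn_leq uj andbT leqNgt; apply/negP => u2.
  have : 2 <= (u 0 j)%:R :> R by rewrite ler_nat.
  by nra.
have ukE : u 0 k = 0%N.
  apply/eqP; rewrite -leqn0 leqNgt; apply/negP => u1.
  have : 1 <= (u 0 k)%:R :> R by rewrite ler1n.
  rewrite ujE in cu; nra.
split=> [|l li]; last first.
  by have := ijk l; rewrite (negbTE li) /= => /orP[]/eqP->; rewrite ?ujE ?ukE.
rewrite -(ler_nat R) -(ler_pM2l wi); move: cu; rewrite ujE ukE; lra.
Qed.

End Faces.

(** * Parts of a polynomial on coordinate subspaces *)

Section Parts.
Variable R : realType.

Lemma expo_le_mdeg k (m : 'X_{1..nvars k}) i : (expo m 0%R i <= mdeg m)%N.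
Proof.
case: k m => m; rewrite mdegE /= mxE.
  by rewrite (bigD1 i) //= leq_addr.
rewrite (big_split_ord _ (m := 3)) /=; apply: leq_add.
  by rewrite (bigD1 i) //= leq_addr.
by rewrite (bigD1 i) //= leq_addr.
Qed.

Lemma expo_eq0 k (m : 'X_{1..nvars k}) : (forall i, expo m 0 i = 0%N) -> m = 0%MM.
Proof.
case: k m => m m0; apply/mnmP => i; rewrite mnm0E.
  by have := m0 i; rewrite mxE.
rewrite -(splitK i); case: fintype.split => l /=; have := m0 l; rewrite mxE => /eqP.
  by rewrite addn_eq0 => /andP[/eqP].
by rewrite addn_eq0 => /andP[_ /eqP].
Qed.

(** Every monomial but the constant one vanishes at the origin, so [f] has no
constant term. *)
Lemma supp_nonconstant k (f : polyfun R k) m : evalf f 0 = 0 -> m \in msupp f ->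
  exists i, (0 < expo m 0%R i)%N.
Proof.
move=> f0 mf; apply/existsP; apply: contraT; rewrite negb_exists => /forallP m0.
have mE : m = 0%MM.
  by apply: expo_eq0 => i; apply/eqP; move: (m0 i); rewrite -eqn0Ngt.
have mon0 m' : m' != 0%MM -> monomial m' (0 : 'rV[ground_field R k]_3) = 0.
  move=> m'n0; have [i m'i] : exists i, expo m' 0 i != 0%N.
    apply/existsP; apply: contraNT m'n0; rewrite negb_exists => /forallP H.
    by apply/eqP/expo_eq0 => i; apply/eqP; move: (H i); rewrite negbK.
  have -> : (0 : 'rV[ground_field R k]_3) = rescale (fun=> 0) 0.
    by apply/rowP => l; rewrite !mxE mulr0.
  rewrite monomial_rescale (bigD1 i) //= expr0n (negbTE m'i) mul0r.
  by rewrite real_scalar0 mul0r.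
move: f0; rewrite /evalf mevalE (bigD1_seq m) //= ?msupp_uniq //.
rewrite [X in _ + X]big1 ?addr0 => [/eqP|m' m'm]; last first.
  by rewrite -/(monomial m' 0) mon0 ?mulr0 // -mE.
rewrite mulf_eq0 mcoeff_eq0 mf /= mE => /eqP.
rewrite big1 => [/eqP|i _]; first by rewrite oner_eq0.
by rewrite mnm0E expr0.
Qed.

Definition indicator (I : {set 'I_3}) (i : 'I_3) : R := (i \in I)%:R.

Lemma prod_indicator (I : {set 'I_3}) (a : 'rV[nat]_3) :
  \prod_i indicator I i ^+ a 0%R i =
  (`[< coord_space I (natr_row R a) >])%:R.
Proof.
case: asboolP => [aI|/existsNP[i /not_implyP[iI]]].
  apply: big1 => i _; rewrite /indicator; case: (boolP (i \in I)) => iI.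
    by rewrite expr1n.
  by have /eqP := aI i iI; rewrite mxE pnatr_eq0 => /eqP ->; rewrite expr0.
rewrite mxE => /eqP; rewrite pnatr_eq0 => ai.
by rewrite (bigD1 i) //= /indicator (negbTE iI) expr0n (negbTE ai) mul0r.
Qed.

(** Projecting onto [K^I] kills exactly the monomials whose exponent leaves
[R^I]. *)
Lemma evalf_part_restrict k (f : polyfun R k) (A B : set 'rV[R]_3) I x :
    (forall m, m \in msupp f -> B (exponent_vec R m) <->
       A (exponent_vec R m) /\ coord_space I (exponent_vec R m)) ->
  evalf (part f A) (rescale (indicator I) x) = evalf (part f B) x.
Proof.
move=> BA; rewrite !evalf_part big_mkcond [RHS]big_mkcond.
apply: eq_big_seq => m mf; rewrite monomial_rescale prod_indicator.
rewrite -exponent_vecE; have /asbool_equiv_eq -> := BA m mf.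
rewrite asbool_and; case: asboolP => //= _; case: asboolP => _ /=.
  by rewrite real_scalar1 mul1r.
by rewrite real_scalar0 mul0r mulr0.
Qed.

Lemma rescale_torus k (I : {set 'I_3}) (x : 'rV[ground_field R k]_3) :
  coord_torus I x ->
  exists2 y, coord_torus [set: 'I_3]%SET y & rescale (indicator I) y = x.
Proof.
move=> [xI x0]; exists (\row_i (if i \in I then x 0 i else 1)).
  split=> i; rewrite ?inE // => _; rewrite mxE; case: ifP => [/x0//|_].
  exact: oner_neq0.
apply/rowP => i; rewrite !mxE /indicator; case: (boolP (i \in I)) => [_|/xI ->].
  by rewrite real_scalar1 mul1r.
by rewrite real_scalar0 mul0r.
Qed.

End Parts.

(** * Nonsingularity on the tori of the faces *)

Section Nonsingularity.
Variables (R : realType) (k : base_field) (f : polyfun R k).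

Lemma supp_natr nu : supp f nu -> exists2 m, m \in msupp f & nu = natr_row R (expo m).
Proof. by move=> [m mf <-]; exists m; rewrite ?exponent_vecE. Qed.

Lemma mem_supp m : m \in msupp f -> supp f (natr_row R (expo m)).
Proof. by move=> mf; exists m; rewrite ?exponent_vecE. Qed.

Lemma expo_le_msize m i : m \in msupp f -> (expo m 0%R i <= msize f)%N.
Proof.
by move=> /msize_mdeg_lt /ltnW; apply: leq_trans; apply: expo_le_mdeg.
Qed.

(** Adding [1] to the weight outside [I] does not change the minimum, attained
at a point of [supp f] in [R^I], but restricts the terms attaining it to [R^I].
KND for the new weight then applies to a lift of the point to the full torus. *)
Lemma nonsing_restriction (w : 'rV[rat]_3) c (Delta : set 'rV[R]_3) I :
    KND f -> positive_weight w ->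
    (forall m, m \in msupp f -> c <= pairing (real_weight R w) (natr_row R (expo m))
       /\ (Delta (natr_row R (expo m)) <->
           pairing (real_weight R w) (natr_row R (expo m)) = c)) ->
    supp f `&` Delta `&` coord_space I !=set0 ->
  sing (part f Delta) `&` zeros (part f Delta) `&` coord_torus I = set0.
Proof.
move=> knd w0 wf [nu [[/supp_natr[m0 m0f ->] Dm0] Im0]].
pose v : 'rV[rat]_3 := \row_i (i \notin I)%:R.
have vE nu' : pairing (real_weight R v) nu' = \sum_(i | i \notin I) nu' 0 i.
  rewrite /pairing [RHS]big_mkcond; apply: eq_bigr => i _; rewrite !mxE.
  by rewrite ratr_nat; case: (i \notin I); rewrite ?mul1r ?mul0r.
have v0 (m : 'X_{1..nvars k}) :
    0 <= pairing (real_weight R v) (natr_row R (expo m)) ?= iff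
    `[< coord_space I (natr_row R (expo m)) >].
  rewrite vE; split; first by apply: sumr_ge0 => i _; rewrite mxE.
  rewrite eq_sym psumr_eq0 => [|i _]; last by rewrite mxE.
  apply/allP/asboolP => [H i iI|H i _]; last by apply/implyP => iI; rewrite H.
  by have := H i (mem_index_enum _); rewrite iI /= => /eqP.
have [|n [n0 [d d0 nE]]] := @integral_multiple R (w + v).
  by move=> i; rewrite !mxE ltr_pwDl.
have pw (m : 'X_{1..nvars k}) :
    pairing (real_weight R (w + v)) (natr_row R (expo m)) =
    pairing (real_weight R w) (natr_row R (expo m)) +
    pairing (real_weight R v) (natr_row R (expo m)).
  by rewrite /real_weight map_mxD pairingDl.
have locus m : m \in msupp f ->
    min_locus (natr_row R n) (supp f) (exponent_vec R m) <->
    Delta (exponent_vec R m) /\ coord_space I (exponent_vec R m).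
  move=> mf; rewrite nE min_locus_scale // exponent_vecE.
  have [wm Dm] := wf _ mf; have [_ [/(_ Dm0) wm0 _]] := wf _ m0f.
  have v0m := v0 m; have /leifP := v0 m0; rewrite asboolT // => /eqP v0m0.
  split=> [[_ /(_ _ (mem_supp m0f))]|[/Dm wmc Im]].
    rewrite !pw wm0 -v0m0 addr0 => wvm.
    have vm0 := v0m.1.
    split; first by apply/Dm; lra.
    apply/asboolP; rewrite -v0m.2 eq_le vm0 /=; lra.
  split; first exact: mem_supp.
  move=> _ /supp_natr[m' m'f ->]; rewrite !pw wmc lerD //.
    by have [] := wf _ m'f.
  by have /leifP := v0 m; rewrite asboolT // => /eqP <-; exact: (v0 m').1.
rewrite -subset0 => x [[singx zerox] /[dup] xI /rescale_torus[y y0 yx]].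
have := knd n n0; rewrite /= -subset0 => /(_ y); apply; split=> //; split.
- apply: (sing_pullback (f := part f Delta) (s := indicator R I)).
    by move=> z; rewrite (evalf_part_restrict _ locus).
  by rewrite yx.
- by rewrite /zeros /= -(evalf_part_restrict _ locus) yx.
Qed.

(** The only term of [f_Delta] involving [x_j] is the part of [f] at [pt], which
is homogeneous of degree [1] in [x_j] under real rescalings. On the torus of
[K^I], where [x_j = 0], moving along [v e_j] therefore changes [f_Delta] at the
constant rate [f_pt (x + v e_j)], which does not vanish for nonzero [v]. *)
Lemma nonsing_transverse (Delta : set 'rV[R]_3) I j pt :
    zeros (part f [set pt]) `&` coord_torus [set: 'I_3]%SET = set0 ->
    Delta pt -> coord_space (j |: I)%SET pt -> j \notin I -> pt 0 j = 1 ->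
    (forall m, m \in msupp f -> Delta (natr_row R (expo m)) ->
       (0 < expo m 0%R j)%N -> natr_row R (expo m) = pt) ->
  sing (part f Delta) `&` zeros (part f Delta) `&` coord_torus I = set0.
Proof.
rewrite -!subset0 => ptn0 Dpt ptI jI ptj onlypt x [[singx _] [xI x0]]; move: singx.
apply: (@nonsing_affine _ _ _ j) => v v0.
pose y := x + v *: delta_mx 0 j.
have yI : coord_torus (j |: I)%SET y.
  split=> l; rewrite !inE.
    rewrite negb_or => /andP[lj lI].
    by rewrite !mxE xI // (negbTE lj) andbF mulr0 addr0.
  rewrite !mxE eqxx /=; have [->|lj] /= := eqVneq l j.
    by rewrite xI // mulr1 add0r.
  by move=> /x0; rewrite mulr0 addr0.
exists (evalf (part f [set pt]) y).
  have [z z0 <-] := rescale_torus yI.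
  rewrite (@evalf_part_restrict _ _ _ _ [set pt]) => [|m _].
    by apply/eqP => fz; apply: (ptn0 z).
  by split=> [->|[]].
pose s (t : R) (l : 'I_3) : R := if l == j then t else 1.
have yE t : x + (real_scalar k t * v) *: delta_mx 0 j = rescale (s t) y.
  apply/rowP => l; rewrite !mxE eqxx /= /s; have [->|lj] := eqVneq l j.
    by rewrite xI // !mulr1 !add0r.
  by rewrite !mulr0 !addr0 real_scalar1 mul1r.
have xE : x = rescale (s 0) y by rewrite -yE real_scalar0 mul0r scale0r addr0.
have sE t (m : 'X_{1..nvars k}) :
    \prod_l s t l ^+ expo m 0%R l = t ^+ expo m 0 j.
  rewrite (bigD1 j) //= /s eqxx big1 ?mulr1 // => l /negbTE ->.
  by rewrite expr1n.
move=> t; rewrite yE [in X in _ = X + _]xE !evalf_part mulr_sumr.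
rewrite big_mkcond [X in _ = X + _]big_mkcond [X in _ = _ + X]big_mkcond.
rewrite -big_split; apply: eq_big_seq => m mf /=.
rewrite !monomial_rescale !sE !exponent_vecE.
case: (asboolP (natr_row R (expo m) = pt)) => mpt.
  have mj : expo m 0 j = 1%N.
    by move: ptj; rewrite -mpt mxE => /eqP; rewrite pnatr_eq1 => /eqP.
  by rewrite mpt !asboolT // mj !expr1 real_scalar0 mul0r mulr0 add0r mulrCA.
rewrite addr0; case: asboolP => // Dm.
have [->|mj] := posnP (expo m 0 j); first by rewrite !expr0.
by case: mpt; apply: onlypt.
Qed.

End Nonsingularity.

Theorem proposition2p15 (R : realType) (k : base_field) (f : polyfun R k)
    (f0 : evalf f 0 = 0) (knd : KND f) (p : 'I_3 -> 'rV[R]_3)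
    (hi : forall i : 'I_3, noncoord f i ->
       exists j : 'I_3, [/\ j != i,
         (supp f `&` newton_boundary (supp f) `&` coord_space [set i; j]%SET)
           (p i)
         & p i 0 j = 1])
    (hii : forall i j : 'I_3, i != j ->
       supp f `&` newton_boundary (supp f) `&` coord_space [set i; j]%SET
         !=set0)
    (hiii : forall i : 'I_3, noncoord f i ->
       zeros (part f [set p i]) `&` coord_torus [set: 'I_3]%SET = set0) :
  IKND f.
Proof.
(* The quadratic bound is the one that makes weights steep on every face
   containing a point N e_i. *)
pose N := ((msize f + 2) ^ 2)%N.
have N0 : (0 < N)%N by rewrite expn_gt0 addn_gt0 orbT.
have ltMN : ((msize f).+1 < N)%N.
  by rewrite -addn2 -[X in (X <= _)%N]expn1 leq_pexp2l // addn2.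
pose A := [seq expo m | m <- msupp f] ++ [seq axis_point N i | i <- enum 'I_3].
have fA m : m \in msupp f -> expo m \in A.
  by move=> mf; rewrite mem_cat; apply/orP; left; apply/mapP; exists m.
have axisA i : axis_point N i \in A.
  by rewrite mem_cat; apply/orP; right; apply/mapP; exists i; rewrite ?mem_enum.
have [a|J [Jfam JA Jface]] := @newton_diagram R A N axisA.
  rewrite mem_cat => /orP[] /mapP[m mf ->]; first exact: supp_nonconstant mf.
  by exists m; rewrite mxE eqxx.
have suppJ : supp f `<=` above J.
  move=> nu /supp_natr[m mf ->]; split=> [i|l]; first by rewrite mxE.
  by apply: JA; apply: fA.
have supp_ne : supp f !=set0.
  by have [nu [[]]] := hii ord0 ord_max isT; exists nu.
have [P wtP] := face_weights_exist (cface_diagram J : set 'rV[R]_3).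
exists J, P; split=> // [w /wtP.1[w0 _]|Delta I faceD inD I0 [nu0 [Dnu0 Inu0]]].
  exact: min_value_above.
have [w [c [w0 Dabove Dw]]] := inner_face_weight Jfam faceD inD.
pose W := real_weight R w.
have W0 i : 0 < W 0 i by rewrite mxE ltr0q.
have aboveA a : a \in A -> above J (natr_row R a).
  by move=> aA; split=> [i|l lJ]; [rewrite mxE | apply: JA].
have cA a : a \in A -> c <= pairing W (natr_row R a).
  by move=> /aboveA/Dw[].
have DW nu : Delta nu -> pairing W nu = c.
  by move=> Dnu; apply: iffLR (Dw _ (Dabove _ Dnu)).2 Dnu.
have WD a : a \in A -> pairing W (natr_row R a) = c -> Delta (natr_row R a).
  by move=> aA; apply: iffRL (Dw _ (aboveA _ aA)).2.
have [suppI|nosupp] := pselect (supp f `&` Delta `&` coord_space I !=set0).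
  apply: (nonsing_restriction knd w0 _ suppI) => m mf.
  exact/Dw/aboveA/fA.
(* Raising the weight outside I produces a point of A in Delta and R^I, which
   under nosupp is some N e_i. *)
pose V : 'rV[R]_3 := \row_i (i \notin I)%:R.
have VE nu : pairing V nu = \sum_(i | i \notin I) nu 0 i.
  rewrite /pairing [RHS]big_mkcond; apply: eq_bigr => i _; rewrite !mxE.
  by case: (i \notin I); rewrite ?mul1r ?mul0r.
have VA a : 0 <= pairing V (natr_row R a).
  by rewrite VE; apply: sumr_ge0 => i _; rewrite mxE.
have [nu0pos nu0J] := Dabove _ Dnu0.
have [|||[a aA aWV] _] := Jface nu0 nu0pos nu0J (W + V) c.
- by move=> i; rewrite mxE addr_ge0 ?(ltW (W0 _)) // mxE ler0n.
- by move=> a aA; rewrite pairingDl (le_trans (cA _ aA)) // lerDl.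
- rewrite pairingDl VE big1 => [|i iI]; last exact: Inu0.
  by rewrite addr0; apply: DW.
have [aW aI] : pairing W (natr_row R a) = c /\ coord_space I (natr_row R a).
  move: aWV; rewrite pairingDl => aWV; have := cA _ aA; have := VA a => Va Wa.
  split; first by lra.
  have : pairing V (natr_row R a) = 0 by lra.
  rewrite VE => /eqP; rewrite psumr_eq0 => [/allP H i iI|i _]; last by rewrite mxE.
  by have := H i (mem_index_enum _); rewrite iI => /eqP.
have [i iI aE] : exists2 i, i \in I & a = axis_point N i.
  have := aA; rewrite mem_cat => /orP[/mapP[m mf aE]|/mapP[i _ aE]].
    case: nosupp; exists (natr_row R a); split=> //; split.
      by rewrite aE; apply: mem_supp.
    exact: WD.
  exists i => //; apply: contraT => /aI; rewrite aE !mxE eqxx => /eqP.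
  by rewrite pnatr_eq0 -leqn0 leqNgt N0.
have WN : W 0 i * N%:R = c by rewrite -aW aE pairing_axis.
have nci : noncoord f i.
  rewrite /noncoord /= -subset0 => nu [/supp_natr[m mf ->] mi].
  have := cA _ (fA _ mf); rewrite -WN /pairing (bigD1 i) //= big1 => [|l li].
    rewrite addr0 [natr_row _ _ _ _]mxE ler_pM2l // ler_nat leqNgt => /negP; apply.
    exact: leq_ltn_trans (expo_le_msize i mf) (ltnW ltMN).
  by rewrite mi ?mulr0 // inE.
have [j [ji [[suppp bdp] pij] pj]] := hi _ nci.
have [mp mpf pE] := supp_natr suppp.
have mpj : expo mp 0 j = 1%N.
  by move: pj; rewrite pE mxE => /eqP; rewrite pnatr_eq1 => /eqP.
have only_p m : m \in msupp f -> Delta (natr_row R (expo m)) ->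
    (0 < expo m 0%R j)%N -> natr_row R (expo m) = p i.
  move=> mf Dm mj.
  have [l [li lj ijl sum3]] := @third_index R _ _ ji.
  have il : i != l by rewrite eq_sym.
  have [_ [[/supp_natr[mq mqf ->] _] qil]] := hii i l il.
  have [||||||mi mE] := @steep_weight R W c i j (msize f) N (expo mp) (expo mq)
    (expo m) ji W0 (leqnn _) WN (fun l => expo_le_msize l mpf)
    (fun l => expo_le_msize l mqf) mpj.
  - move=> l' /pij/eqP; rewrite pE mxE pnatr_eq0 => /eqP; exact.
  - have := qil j; rewrite !inE negb_or ji eq_sym lj => /(_ isT)/eqP.
    by rewrite mxE pnatr_eq0 => /eqP.
  - exact/cA/fA.
  - exact/cA/fA.
  - exact: DW.
  - exact: mj.
  rewrite pE; apply/rowP => l'; rewrite !mxE.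
  have [->|/mE -> //] := eqVneq l' i.
  apply/eqP; rewrite eqr_nat eqn_leq mi leqNgt; apply/negP => lt_mi.
  (* otherwise a point of the support lies strictly below p i *)
  pose t : R := (expo mp 0 i)%:R - (expo m 0 i)%:R.
  have t0 : 0 < t by rewrite subr_gt0 ltr_nat.
  apply: (newton_boundary_minimal (i := i) suppp bdp t0).
  suff -> : p i - t *: delta_mx 0 i = natr_row R (expo m) by apply: mem_supp.
  rewrite pE; apply/rowP => r; rewrite !mxE eqxx /=.
  have [->|/[dup] ri /mE ->] := eqVneq r i; first by rewrite mulr1 subKr.
  by rewrite mulr0 subr0.
(* Delta leaves the plane nu_j = 0 only through p i: a second point N e_j in
   Delta would give w_j = w_i, contradicting the steepness of w. *)
have pD : Delta (p i).
  have /existsNP[nu /not_implyP[Dnu]] : ~ (Delta `<=` coord_space (~: [set j])%SET).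
    by apply: inD; apply/eqP => /setP/(_ j); rewrite !inE eqxx.
  move=> /existsNP[l /not_implyP[]]; rewrite !inE negbK => /eqP -> /eqP nuj.
  have [nupos nuJ] := Dabove _ Dnu.
  have [|||_ /(_ j)[||b]] := Jface nu nupos nuJ W c.
  - by move=> l'; rewrite ltW.
  - exact: cA.
  - exact: DW.
  - exact: W0.
  - by rewrite lt_def nuj nupos.
  rewrite mem_cat => /orP[/mapP[m mf ->]|/mapP[l' _ ->]] [bW bj].
    by rewrite -(only_p _ mf) //; apply: WD => //; apply: fA.
  move: bj; rewrite mxE; case: eqP => // jl' _; move: bW.
  rewrite pairing_axis -jl' -WN => /mulIf Wji.
  have {}Wji : W 0 j = W 0 i by apply: Wji; rewrite pnatr_eq0 -lt0n.
  have [l2 [li lj ijl sum3]] := @third_index R _ _ ji.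
  have := cA _ (fA _ mpf); rewrite -WN -pE /pairing sum3 pj mulr1 (pij l2); last first.
    by rewrite !inE negb_or li lj.
  rewrite mulr0 addr0 Wji pE [natr_row _ _ _ _]mxE.
  rewrite -[X in _ + X]mulr1 -mulrDr ler_pM2l // natr1 ler_nat leqNgt.
  by rewrite (leq_ltn_trans _ ltMN) // ltnS expo_le_msize.
have jI : j \notin I.
  apply/negP => jI; apply: nosupp; exists (p i); split=> // l lI.
  by apply: pij; rewrite !inE negb_or; apply/andP; split;
    apply: contraNneq lI => ->.
apply: (nonsing_transverse (hiii _ nci) pD _ jI pj only_p).
move=> l lI; apply: pij; apply: contraNN lI; rewrite !inE => /orP[]/eqP->.
  by rewrite iI orbT.
by rewrite eqxx.
Qed.
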